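(* Let $\gamma_{1},\dots,\gamma_{d}\in\mathbb{R}^{d}$ be linearly independent, $\mathcal{R}=\gamma_{1}\mathbb{Z}\oplus\cdots\oplus\gamma_{d}\mathbb{Z}$, let $A\in\mathbb{R}^{d\times d}$ be the matrix whose $j$-th row is $\gamma_{j}^{T}/\Vert\gamma_{j}\Vert$, and put $\tilde{\mathbf{r}}=(\tilde{x}_{1},\dots,\tilde{x}_{d})^{T}=A^{-1}\mathbf{r}$. Let $V\in\bigotimes_{j=1}^{d}C_{p}^{0}(\mathbb{R})$ be $\mathcal{R}$-periodic and $\lambda\in\mathbb{R}$. Then every bounded solution $\Psi\in\bigotimes_{j=1}^{d}C_{p}^{2}(\mathbb{R})$ of $-\tfrac{1}{2}\Delta\Psi+V\Psi=\lambda\Psi$ that is separable, i.e. $\Psi(\mathbf{r})=\prod_{j=1}^{d}\psi_{j}(\tilde{x}_{j})$ for functions $\psi_j$ of one variable, is either a Bloch solution or a linear combination of Bloch solutions, with real quasimomenta.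
   Context: $C_{p}^{0}(I)$: integrable piecewise-continuous functions on an interval $I$ (finitely many discontinuities on each finite subinterval, and at each discontinuity the one-sided improper integrals of $|f|$ converge); $C_{p}^{l}(I)$: functions differentiable on $I$ with derivative in $C_{p}^{l-1}(I)$. A function on $\mathbb{R}^{d}$ belongs to $\bigotimes_{j=1}^{d}C_{p}^{l}(\mathbb{R})$ if it is in $C_{p}^{l}(\mathbb{R})$ in each of the directions $\pm\gamma_{j}$. $V$ is $\mathcal{R}$-periodic if $V(\mathbf{r}+a)=V(\mathbf{r})$ for all $a\in\mathcal{R}$. A Bloch solution is a solution of the form $\Psi(\mathbf{r})=e^{\mathrm{i}\mathbf{k}\cdot\tilde{\mathbf{r}}}p(\tilde{\mathbf{r}})$, where $\mathbf{k}=(k_1,\dots,k_d)^T\in\mathbb{C}^{d}$ is its quasimomentum and $p$ is periodic with period $\Vert\gamma_j\Vert$ in the variable $\tilde{x}_j$ for each $j$.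
   Formalization: The formal theorem takes γ_j/‖γ_j‖ as the j-th column of A, not the j-th row, so that r̃ = A^{-1}r gives the coordinates of r along the lattice vectors; with rows the claim is false, e.g. for a rectangular lattice rotated by 45° with incommensurable side lengths. *)

(* Defs.v *)
From Stdlib Require Import Reals List.
From Coquelicot Require Import Coquelicot.
From mathcomp Require Import all_boot all_algebra.
From mathcomp Require Import Rstruct.

Set Implicit Arguments.
Unset Strict Implicit.
Unset Printing Implicit Defensive.

Local Open Scope R_scope.

Definition vec (d : nat) := 'cV[R]_d.

Definition coord {d : nat} (v : vec d) (i : 'I_d) : R := v i ord0.

Definition vadd {d : nat} (u v : vec d) : vec d := addmx u v.
Definition vscale {d : nat} (t : R) (v : vec d) : vec d := scalemx t v.
Definition vsum {d n : nat} (F : 'I_n -> vec d) : vec d :=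
  \big[@addmx R d 1 / const_mx 0]_(m < n) F m.
Definition evec {d : nat} (i : 'I_d) : vec d := delta_mx i ord0.

Definition enorm {d : nat} (v : vec d) : R :=
  sqrt (\big[Rplus/0]_(i < d) (coord v i * coord v i)).

Definition lin_indep {d : nat} (gamma : 'I_d -> vec d) : Prop :=
  forall c : 'I_d -> R,
    vsum (fun j => vscale (c j) (gamma j)) = const_mx 0 ->
    forall j, c j = 0.

Definition in_lattice {d : nat} (gamma : 'I_d -> vec d) (a : vec d) : Prop :=
  exists n : 'I_d -> Z, a = vsum (fun j => vscale (IZR (n j)) (gamma j)).

Definition lattice_periodic {d : nat} {T : Type} (gamma : 'I_d -> vec d)
  (V : vec d -> T) : Prop :=
  forall a r, in_lattice gamma a -> V (vadd r a) = V r.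

Definition Amat {d : nat} (gamma : 'I_d -> vec d) : 'M[R]_d :=
  \matrix_(i, j) (coord (gamma j) i / enorm (gamma j)).

Definition tilde {d : nat} (gamma : 'I_d -> vec d) (r : vec d) : vec d :=
  mulmx (invmx (Amat gamma)) r.

Definition Cp0 {V : NormedModule R_AbsRing} (f : R -> V) : Prop :=
  (forall a b : R, exists l : list R,
     forall x, a <= x <= b -> ~ continuous f x -> In x l) /\
  (forall c : R, ~ continuous f c ->
     (exists a : R, a < c /\
        (forall t, a < t < c -> ex_RInt (fun x => norm (f x)) a t) /\
        exists L : R,
          filterlim (fun t => RInt (fun x => norm (f x)) a t)
                    (at_left c) (locally L)) /\
     (exists b : R, c < b /\
        (forall t, c < t < b -> ex_RInt (fun x => norm (f x)) t b) /\
        exists L : R,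
          filterlim (fun t => RInt (fun x => norm (f x)) t b)
                    (at_right c) (locally L))).

Fixpoint Cp {V : NormedModule R_AbsRing} (l : nat) (f : R -> V) : Prop :=
  match l with
  | O => Cp0 f
  | S l' => exists g : R -> V, (forall x, is_derive f x (g x)) /\ Cp l' g
  end.

Definition tensorCp {d : nat} {V : NormedModule R_AbsRing}
  (gamma : 'I_d -> vec d) (l : nat) (F : vec d -> V) : Prop :=
  forall (j : 'I_d) (r : vec d) (s : bool),
    Cp l (fun t => F (vadd r (vscale (if s then t else - t) (gamma j)))).

Definition second_derive_at (phi : R -> C) (t0 : R) (L : C) : Prop :=
  exists phi' : R -> C,
    locally t0 (fun t => is_derive phi t (phi' t)) /\ is_derive phi' t0 L.

Definition is_solution {d : nat} (V : vec d -> R) (lambda : R)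
  (Psi : vec d -> C) : Prop :=
  forall r : vec d, exists L : 'I_d -> C,
    (forall i, second_derive_at (fun t => Psi (vadd r (vscale t (evec i)))) 0 (L i)) /\
    Cplus (Cmult (RtoC (-1/2)) (\big[Cplus/RtoC 0]_(i < d) L i))
          (Cmult (RtoC (V r)) (Psi r))
    = Cmult (RtoC lambda) (Psi r).

Definition bounded_fun {d : nat} (Psi : vec d -> C) : Prop :=
  exists M : R, forall r, Cmod (Psi r) <= M.

Definition separable {d : nat} (gamma : 'I_d -> vec d) (Psi : vec d -> C) : Prop :=
  exists psi : 'I_d -> R -> C,
    forall r, Psi r = \big[Cmult/RtoC 1]_(j < d) psi j (coord (tilde gamma r) j).

Definition Cexp (z : C) : C :=
  (exp (fst z) * cos (snd z), exp (fst z) * sin (snd z)).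

Definition Ci : C := (0, 1).

Definition tilde_periodic {d : nat} (gamma : 'I_d -> vec d) (p : vec d -> C) : Prop :=
  forall (j : 'I_d) (y : vec d),
    p (vadd y (vscale (enorm (gamma j)) (evec j))) = p y.

Definition Bloch_solution {d : nat} (gamma : 'I_d -> vec d) (V : vec d -> R)
  (lambda : R) (Phi : vec d -> C) (k : 'I_d -> C) : Prop :=
  is_solution V lambda Phi /\
  exists p : vec d -> C,
    tilde_periodic gamma p /\
    forall r, Phi r =
      Cmult (Cexp (Cmult Ci (\big[Cplus/RtoC 0]_(j < d)
                               Cmult (k j) (RtoC (coord (tilde gamma r) j)))))
            (p (tilde gamma r)).

(* Main.v *)
(** Along the line [r0 + t gamma_j] the function [Psi] is, up to the nonzero
    constant [Psi r0], its own [j]-th factor [g].  Since the other factors do not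
    depend on [t], the equation restricts to [g'' = a g' + (b V + c) g] with
    constants [a], [b], [c] and [1]-periodic [V].  By uniqueness for this
    equation [g], [T g], [T^2 g] are linearly dependent, [T] being the unit
    translation, so [(T - mu) (T - nu) g = 0]; boundedness forces
    [|mu| = |nu| = 1] and excludes a Jordan block.  The same relation then holds
    for [Psi] and the translation [T_j] by [gamma_j].

    Because the equation is linear and invariant under [T_j], the projections
    [(T_j - nu) / (mu - nu)] and [(T_j - mu) / (nu - mu)] map solutions to
    solutions.  Applying them for every [j] writes [Psi] as a combination of
    solutions that are eigenfunctions of all [T_j] with unimodular eigenvalues,
    and such a function is a Bloch solution with real quasimomentum. *)

Require Import Defs.
From Stdlib Require Import Reals Lra List Classical FunctionalExtensionality.
From Coquelicot Require Import Coquelicot.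
From HB Require Import structures.
From mathcomp Require Import all_boot all_algebra.
From mathcomp Require Import Rstruct.

Set Implicit Arguments.
Unset Strict Implicit.
Unset Printing Implicit Defensive.

Local Open Scope R_scope.

Local Notation coord := Defs.coord.

(* [ring] does not see through [NormedModule.sort], the carrier in which
   derivatives of [R -> C] functions live. *)
Ltac Cring := match goal with |- @eq _ ?u ?v => change (@eq C u v) end; ring.

(** * Differentiation of complex-valued functions *)

Lemma is_derive_pair (f : R -> C) (x : R) (l : C) :
  is_derive f x l <->
  is_derive (fun t => fst (f t)) x (fst l) /\
  is_derive (fun t => snd (f t)) x (snd l).
Proof.
split=> [Hf | [H1 H2]].
- split.
  + apply: (filterdiff_comp f fst _ fst Hf).
    exact: filterdiff_linear is_linear_fst.
  + apply: (filterdiff_comp f snd _ snd Hf).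
    exact: filterdiff_linear is_linear_snd.
- apply: (@filterdiff_ext _ _ _ _ _ (fun t => (fst (f t), snd (f t)))).
    by move=> y; case: (f y).
  apply: (filterdiff_ext_lin _ (fun y : R => (scal y (fst l), scal y (snd l)))).
    apply: (filterdiff_comp_2 _ _ (fun u v : R => (u, v)) _ _ (fun u v : R => (u, v)) H1 H2).
    rewrite (_ : (fun t : R * R => (t.1, t.2)) = id); first exact: filterdiff_id.
    by apply: functional_extensionality; case.
  by [].
Qed.

Lemma is_derive_C_unique (f : R -> C) (x : R) (l1 l2 : C) :
  is_derive f x l1 -> is_derive f x l2 -> l1 = l2.
Proof.
move=> /is_derive_pair [H1 H2] /is_derive_pair [H3 H4].
rewrite (surjective_pairing l1) (surjective_pairing l2).
rewrite -(is_derive_unique _ _ _ H1) -(is_derive_unique _ _ _ H2).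
by rewrite -(is_derive_unique _ _ _ H3) -(is_derive_unique _ _ _ H4).
Qed.

Lemma is_derive_Cplus (f g : R -> C) (x : R) (l m : C) :
  is_derive f x l -> is_derive g x m ->
  is_derive (fun t => Cplus (f t) (g t)) x (Cplus l m).
Proof. exact: is_derive_plus. Qed.

Lemma is_derive_Cmult (f g : R -> C) (x : R) (l m : C) :
  is_derive f x l -> is_derive g x m ->
  is_derive (fun t => Cmult (f t) (g t)) x
    (Cplus (Cmult l (g x)) (Cmult (f x) m)).
Proof.
move=> /is_derive_pair [H1 H2] /is_derive_pair [H3 H4].
apply/is_derive_pair; split=> /=.
- have := is_derive_minus _ _ _ _ _ (is_derive_mult _ _ _ _ _ H1 H3 Rmult_comm)
    (is_derive_mult _ _ _ _ _ H2 H4 Rmult_comm).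
  rewrite /minus /plus /opp /mult /= => H.
  by replace (_ - _ + _) with
    (fst l * fst (g x) + fst (f x) * fst m + - (snd l * snd (g x) + snd (f x) * snd m))
    by ring.
- have := is_derive_plus _ _ _ _ _ (is_derive_mult _ _ _ _ _ H1 H4 Rmult_comm)
    (is_derive_mult _ _ _ _ _ H2 H3 Rmult_comm).
  rewrite /plus /mult /= => H.
  by replace (_ + _ + _) with
    (fst l * snd (g x) + fst (f x) * snd m + (snd l * fst (g x) + snd (f x) * fst m))
    by ring.
Qed.

Lemma is_derive_Cconst (c : C) (x : R) : is_derive (fun _ : R => c) x (RtoC 0).
Proof. exact: is_derive_const. Qed.

Lemma is_derive_Cscal (c : C) (f : R -> C) (x : R) (l : C) :
  is_derive f x l -> is_derive (fun t => Cmult c (f t)) x (Cmult c l).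
Proof.
move=> Hf; have := is_derive_Cmult (is_derive_Cconst c x) Hf.
by rewrite Cmult_0_l Cplus_0_l.
Qed.

Lemma is_derive_Caffine (f : R -> C) (b u x : R) (l : C) :
  is_derive f (b + x * u) l ->
  is_derive (fun t => f (b + t * u)) x (Cmult (RtoC u) l).
Proof.
move=> Hf; rewrite -scal_R_Cmult.
apply: (is_derive_comp f (fun t => b + t * u)) => //.
by auto_derive => //; ring.
Qed.

(** Both derivatives are carried as functions, so that the rules below compute explicit formulas for
    them. *)
Definition twice_derivable (f f1 f2 : R -> C) : Prop :=
  forall x, is_derive f x (f1 x) /\ is_derive f1 x (f2 x).

Lemma twice_derivable_const (c : C) :
  twice_derivable (fun=> c) (fun=> RtoC 0) (fun=> RtoC 0).
Proof. by move=> x; split; apply: is_derive_Cconst. Qed.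

Lemma twice_derivable_plus (f f1 f2 g g1 g2 : R -> C) :
  twice_derivable f f1 f2 -> twice_derivable g g1 g2 ->
  twice_derivable (fun x => Cplus (f x) (g x)) (fun x => Cplus (f1 x) (g1 x))
    (fun x => Cplus (f2 x) (g2 x)).
Proof.
move=> Hf Hg x; have [Hf1 Hf2] := Hf x; have [Hg1 Hg2] := Hg x.
by split; apply: is_derive_Cplus.
Qed.

Lemma twice_derivable_scal (c : C) (f f1 f2 : R -> C) :
  twice_derivable f f1 f2 ->
  twice_derivable (fun x => Cmult c (f x)) (fun x => Cmult c (f1 x))
    (fun x => Cmult c (f2 x)).
Proof.
by move=> Hf x; have [Hf1 Hf2] := Hf x; split; apply: is_derive_Cscal.
Qed.

Lemma twice_derivable_affine (f f1 f2 : R -> C) (b u : R) :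
  twice_derivable f f1 f2 ->
  twice_derivable (fun x => f (b + x * u)) (fun x => Cmult (RtoC u) (f1 (b + x * u)))
    (fun x => Cmult (RtoC (u * u)) (f2 (b + x * u))).
Proof.
move=> Hf x; have [Hf1 Hf2] := Hf (b + x * u).
split; first exact: is_derive_Caffine.
rewrite RtoC_mult -Cmult_assoc.
by apply: is_derive_Cscal; apply: is_derive_Caffine.
Qed.

Lemma twice_derivable_mult (f f1 f2 g g1 g2 : R -> C) :
  twice_derivable f f1 f2 -> twice_derivable g g1 g2 ->
  twice_derivable (fun x => Cmult (f x) (g x))
    (fun x => Cplus (Cmult (f1 x) (g x)) (Cmult (f x) (g1 x)))
    (fun x => Cplus (Cplus (Cmult (f2 x) (g x)) (Cmult (f1 x) (g1 x)))
                    (Cplus (Cmult (f1 x) (g1 x)) (Cmult (f x) (g2 x)))).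
Proof.
move=> Hf Hg x; have [Hf1 Hf2] := Hf x; have [Hg1 Hg2] := Hg x.
split; first exact: is_derive_Cmult.
by apply: is_derive_Cplus; apply: is_derive_Cmult.
Qed.

(** Near [t] the first derivative hidden in [second_derive_at] must coincide with [f1], so the two
    have the same derivative at [t]. *)
Lemma second_derive_at_twice_derivable (f f1 f2 : R -> C) (t : R) (L : C) :
  twice_derivable f f1 f2 -> second_derive_at f t L -> L = f2 t.
Proof.
move=> Hf [phi [Hloc HL]]; apply: is_derive_C_unique (proj2 (Hf t)).
apply: (is_derive_ext_loc phi) => //.
apply: filter_imp Hloc => s Hs.
exact: is_derive_C_unique Hs (proj1 (Hf s)).
Qed.

(** * Uniqueness for linear second order equations *)

Lemma list_right_gap (l : list R) (c : R) :
  exists b, c < b /\ forall x, c < x < b -> ~ In x l.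
Proof.
elim: l => [|y l [b [Hcb Hb]]]; first by exists (c + 1); split; [lra | move=> x _ []].
case: (Rle_dec y c) => Hy.
- exists b; split=> // x Hx [Hyx | Hin]; [lra | exact: Hb Hin].
- exists (Rmin b y); split; first by apply: Rmin_glb_lt => //; lra.
  move=> x [Hcx Hx] [Hyx | Hin].
  + have := Rmin_r b y; lra.
  + by apply: (Hb x) => //; have := Rmin_l b y; lra.
Qed.

Lemma locally_interval_open (a b t : R) :
  a < t < b -> locally t (fun s => a < s < b).
Proof. exact: (open_and _ _ (open_gt a) (open_lt b)). Qed.

Lemma ex_RInt_abs_continuous (V : R -> R) (a b : R) :
  a <= b -> (forall x, a <= x <= b -> continuous V x) ->
  ex_RInt (fun x => Rabs (V x)) a b.
Proof.
move=> Hab HV; apply: (@ex_RInt_continuous R_CompleteNormedModule) => x.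
rewrite Rmin_left // Rmax_right // => Hx.
by apply: (continuous_comp V Rabs); [exact: HV | exact: continuous_Rabs].
Qed.

(* A primitive of [|V|] to the right of [c] that stays bounded below at [c]:
   all that the Gronwall argument needs from the improper integrability of
   [V] at a discontinuity. *)
Definition right_primitive_abs (V : R -> R) (c : R) : Prop :=
  exists (b B : R) (phi : R -> R), c < b /\
    forall t, c < t < b -> is_derive phi t (Rabs (V t)) /\ - B <= phi t.

(** Finitely many discontinuities near [c] leave an interval to the right of [c] on which [V] is
    continuous. At a continuity point the primitive starts from [c]; otherwise it starts from a
    point to the right, and convergence of the improper integral bounds it. *)
Lemma Cp0_right_primitive_abs (V : R -> R) (c : R) :
  @Cp0 R_NormedModule V -> right_primitive_abs V c.
Proof.
move=> [Hfin Hint].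
have [b1 [Hb1 Hcont]] : exists b, c < b /\ forall x, c < x < b -> continuous V x.
  have [l Hl] := Hfin c (c + 1).
  have [b [Hcb Hb]] := list_right_gap l c.
  exists (Rmin b (c + 1)); split; first by apply: Rmin_glb_lt => //; lra.
  move=> x [Hcx Hx]; have H1 := Rmin_l b (c + 1); have H2 := Rmin_r b (c + 1).
  apply: NNPP => Hn; apply: (Hb x); first lra.
  by apply: Hl => //; lra.
have HcontA x : c < x < b1 -> continuous (fun x => Rabs (V x)) x.
  by move=> Hx; apply: (continuous_comp V Rabs); [exact: Hcont | exact: continuous_Rabs].
case: (classic (continuous V c)) => Hc.
- exists b1, 0, (fun t => RInt (fun x => Rabs (V x)) c t); split=> // t Ht.
  have Hex s : c <= s < b1 -> ex_RInt (fun x => Rabs (V x)) c s.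
    move=> Hs; apply: ex_RInt_abs_continuous; first lra.
    move=> x Hx; case: (Req_dec x c) => [-> // | Hne]; apply: Hcont; lra.
  split.
  + apply: (@is_derive_RInt R_NormedModule (fun x => Rabs (V x)) _ c); last exact: HcontA.
    apply: filter_imp (locally_interval_open Ht) => s Hs; apply: RInt_correct; apply: Hex; lra.
  + rewrite Ropp_0; apply: RInt_ge_0; [lra | apply: Hex; lra |].
    by move=> x _; apply: Rabs_pos.
- have [_ [b [Hcb [Hex [L HL]]]]] := Hint c Hc.
  have {}Hex t : c < t < b -> ex_RInt (fun x => Rabs (V x)) t b by exact: Hex.
  have [eps Heps] : at_right c (fun t => RInt (fun x => Rabs (V x)) t b < L + 1).
    have Hl : L < L + 1 by lra.
    exact: (HL _ (open_lt (L + 1) L Hl)).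
  (* Within [eps] of [c] the integral over [[t, b]] is below [L + 1], so its opposite is above
     [- (L + 1)]. *)
  exists (Rmin (Rmin b b1) (c + eps)), (L + 1),
    (fun t => - RInt (fun x => Rabs (V x)) t b).
  have He := cond_pos eps.
  split; first by repeat apply: Rmin_glb_lt => //; lra.
  move=> t [Hct Ht].
  have H1 := Rmin_l (Rmin b b1) (c + eps); have H2 := Rmin_r (Rmin b b1) (c + eps).
  have H3 := Rmin_l b b1; have H4 := Rmin_r b b1.
  split.
  + have H : is_derive (fun t => RInt (fun x => Rabs (V x)) t b) t (Hierarchy.opp (Rabs (V t))).
      apply: (@is_derive_RInt' R_NormedModule (fun x => Rabs (V x))); last by apply: HcontA; lra.
      have Htb : c < t < b by lra.
      apply: filter_imp (locally_interval_open Htb) => s Hs; apply: RInt_correct; apply: Hex; lra.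
    have := is_derive_opp _ _ _ H; by rewrite Hierarchy.opp_opp.
  + have : RInt (fun x => Rabs (V x)) t b < L + 1.
      apply: Heps => //; rewrite /ball /= /AbsRing_ball /abs /minus /plus /Hierarchy.opp /=.
      by rewrite Rabs_pos_eq; lra.
    lra.
Qed.

(** The product [E] of [N] with an integrating factor is nonincreasing to the right of [c]. The
    factor stays bounded near [c] because [phi] is bounded below, and [N] tends to [0] there, so [E]
    cannot be positive. *)
Lemma gronwall_right (N N1 phi v : R -> R) (c b K B : R) :
  c < b -> continuous N c -> N c = 0 -> 0 <= K ->
  (forall t, c < t < b ->
     [/\ is_derive N t (N1 t), is_derive phi t (v t), - B <= phi t, 0 <= N t
       & N1 t <= K * (1 + v t) * N t]) ->
  forall t, c < t < b -> N t = 0.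
Proof.
move=> Hcb Ncont Nc HK H t Ht.
pose E s := N s * exp (- K * (s + phi s)).
have HE s : c < s < b ->
    is_derive E s ((N1 s - K * (1 + v s) * N s) * exp (- K * (s + phi s))).
  move=> Hs; have [HN Hphi _ _ _] := H s Hs.
  rewrite /E; auto_derive.
    by split; [exists (N1 s) | split; [exists (v s) |]].
  by rewrite (is_derive_unique _ _ _ HN) (is_derive_unique _ _ _ Hphi); ring.
have Edecr s : c < s < t -> E t <= E s.
  move=> Hs.
  have [x [Hx Heq]] := MVT_gen E s t
    (fun s => (N1 s - K * (1 + v s) * N s) * exp (- K * (s + phi s)))
    (fun x Hx => HE x ltac:(move: Hx; rewrite Rmin_left ?Rmax_right; lra))
    (fun x Hx => proj2 (continuity_pt_filterlim E x)
       (ex_derive_continuous E x (ex_intro _ _ (HE x ltac:(move: Hx; rewrite Rmin_left ?Rmax_right; lra))))).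
  move: Hx; rewrite Rmin_left ?Rmax_right; [|lra..] => Hx.
  have [_ _ _ _ Hle] := H x ltac:(lra).
  have Hexp := exp_pos (- K * (x + phi x)).
  have : (N1 x - K * (1 + v x) * N x) * exp (- K * (x + phi x)) * (t - s) <= 0.
    have : 0 <= (K * (1 + v x) * N x - N1 x) * exp (- K * (x + phi x)) * (t - s).
      by apply: Rmult_le_pos; [apply: Rmult_le_pos|]; lra.
    lra.
  lra.
(* An upper bound for the integrating factor, from [s > c] and [phi s >= - B]. *)
pose M := exp (K * (B - c)).
have HM : 0 < M by exact: exp_pos.
have EM s : c < s < t -> E t <= N s * M.
  move=> Hs; apply: Rle_trans (Edecr s Hs) _.
  have [_ _ Hp HN _] := H s ltac:(lra).
  apply: Rmult_le_compat_l => //.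
  have Hle : - K * (s + phi s) <= K * (B - c).
    have : 0 <= K * (s + phi s + (B - c)) by apply: Rmult_le_pos; lra.
    lra.
  case: Hle => [Hlt | ->]; [left; exact: exp_increasing | exact: Rle_refl].
have Et : E t <= 0.
  apply: Rnot_lt_le => Hpos.
  have [eps Heps] : locally c (fun s => N s < E t / M).
    have Hl : N c < E t / M by rewrite Nc; exact: Rdiv_lt_0_compat.
    exact: (Ncont _ (open_lt (E t / M) (N c) Hl)).
  have He := cond_pos eps.
  pose s := Rmin (c + eps / 2) ((c + t) / 2).
  have Hs1 := Rmin_l (c + eps / 2) ((c + t) / 2).
  have Hs2 := Rmin_r (c + eps / 2) ((c + t) / 2).
  have Hs3 : c < s by apply: Rmin_glb_lt; lra.
  have HNs : N s < E t / M.
    apply: Heps; rewrite /ball /= /AbsRing_ball /abs /minus /plus /Hierarchy.opp /=.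
    rewrite Rabs_pos_eq -/s; rewrite -/s in Hs1; lra.
  have := EM s ltac:(rewrite -/s in Hs2; lra).
  have : N s * M < E t by apply/Rlt_div_r.
  lra.
have [_ _ _ HN _] := H t Ht.
have Hexp := exp_pos (- K * (t + phi t)).
apply: Rle_antisym => //.
apply: Rnot_lt_le => Hpos; have := Rmult_lt_0_compat _ _ Hpos Hexp.
rewrite -/(E t); lra.
Qed.

(** Cauchy-Schwarz in the plane: the left side is the real part of the conjugate of [u] times
    [w]. *)
Lemma Cdot_le_Cmod (u w : C) :
  fst u * fst w + snd u * snd w <= Cmod u * Cmod w.
Proof.
rewrite -(Cmod_conj u) -Cmod_mult.
apply: Rle_trans (Rle_trans _ _ _ (Rle_abs _) (re_le_Cmod _)).
by right; rewrite /Re /=; ring.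
Qed.

Lemma Cmod_sqr (u : C) : Cmod u * Cmod u = fst u * fst u + snd u * snd u.
Proof. by rewrite /Cmod sqrt_sqrt; [ring | nra]. Qed.

Lemma is_derive_sum_sqr (u v : R -> R) (x du dv : R) :
  is_derive u x du -> is_derive v x dv ->
  is_derive (fun t => u t * u t + v t * v t) x (2 * (u x * du + v x * dv)).
Proof.
move=> Hu Hv; auto_derive.
  by do !split=> //; [exists du | exists du | exists dv | exists dv].
by rewrite (is_derive_unique _ _ _ Hu) (is_derive_unique _ _ _ Hv); ring.
Qed.

Definition linear_ode (a b c : C) (V : R -> R) (h h1 : R -> C) : Prop :=
  exists h2, twice_derivable h h1 h2 /\
    forall x, h2 x = Cplus (Cmult a (h1 x))
                           (Cmult (Cplus (Cmult b (RtoC (V x))) c) (h x)).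

Lemma linear_ode_shift (a b c : C) (V : R -> R) (h h1 : R -> C) :
  (forall x, V (x + 1) = V x) -> linear_ode a b c V h h1 ->
  linear_ode a b c V (fun x => h (x + 1)) (fun x => h1 (x + 1)).
Proof.
move=> HV [h2 [Hd Heq]]; exists (fun x => h2 (x + 1)); split.
- move=> x; have [H1 H2] := twice_derivable_affine 1 1 Hd x.
  rewrite !Rmult_1_r !Cmult_1_l (Rplus_comm 1 x) in H1 H2.
  split.
  + apply: is_derive_ext H1 => t; by rewrite Rmult_1_r Rplus_comm.
  + apply: is_derive_ext H2 => t; by rewrite Cmult_1_l Rmult_1_r Rplus_comm.
- by move=> x; rewrite Heq HV.
Qed.

Lemma linear_ode_plus (a b c : C) (V : R -> R) (f f1 g g1 : R -> C) :
  linear_ode a b c V f f1 -> linear_ode a b c V g g1 ->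
  linear_ode a b c V (fun x => Cplus (f x) (g x)) (fun x => Cplus (f1 x) (g1 x)).
Proof.
move=> [f2 [Hf Ef]] [g2 [Hg Eg]]; exists (fun x => Cplus (f2 x) (g2 x)); split.
- exact: twice_derivable_plus.
- by move=> x; rewrite Ef Eg; ring.
Qed.

Lemma linear_ode_scal (a b c k : C) (V : R -> R) (f f1 : R -> C) :
  linear_ode a b c V f f1 ->
  linear_ode a b c V (fun x => Cmult k (f x)) (fun x => Cmult k (f1 x)).
Proof.
move=> [f2 [Hf Ef]]; exists (fun x => Cmult k (f2 x)); split.
- exact: twice_derivable_scal.
- by move=> x; rewrite Ef; ring.
Qed.

Lemma RtoC_N1 : RtoC (-1) = Copp (RtoC 1).
Proof. by rewrite -RtoC_opp; congr RtoC; ring. Qed.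

(** Reflection turns uniqueness to the left of a point into uniqueness to its right. *)
Lemma linear_ode_opp (a b c : C) (V : R -> R) (h h1 : R -> C) :
  linear_ode a b c V h h1 ->
  linear_ode (Copp a) b c (fun x => V (- x)) (fun x => h (- x))
    (fun x => Copp (h1 (- x))).
Proof.
move=> [h2 [Hd Heq]]; exists (fun x => h2 (- x)); split; last first.
  by move=> x; rewrite Heq; ring.
move=> x; have [H1 H2] := twice_derivable_affine 0 (-1) Hd x.
have E t : 0 + t * -1 = - t by ring.
rewrite E in H1 H2; split.
- apply: (is_derive_ext (fun t => h (0 + t * -1))); first by move=> t; rewrite E.
  by replace (Copp (h1 (- x))) with (Cmult (RtoC (-1)) (h1 (- x))) by (rewrite RtoC_N1; ring).
- apply: (is_derive_ext (fun t => Cmult (RtoC (-1)) (h1 (0 + t * -1)))).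
    by move=> t; rewrite E RtoC_N1; Cring.
  replace (h2 (- x)) with (Cmult (RtoC (-1 * -1)) (h2 (- x))) => //.
  rewrite RtoC_mult RtoC_N1; Cring.
Qed.

Section Uniqueness.
Variables (a b c : C) (V : R -> R) (h h1 : R -> C).
Hypothesis Hode : linear_ode a b c V h h1.

Let energy (t : R) : R := Cmod (h t) * Cmod (h t) + Cmod (h1 t) * Cmod (h1 t).

Lemma energy_ge0 (t : R) : 0 <= energy t.
Proof. by rewrite /energy; nra. Qed.

Lemma energy_eq0 (t : R) : energy t = 0 -> h t = RtoC 0 /\ h1 t = RtoC 0.
Proof.
rewrite /energy => H; have H1 := Cmod_ge_0 (h t); have H2 := Cmod_ge_0 (h1 t).
by split; apply: Cmod_eq_0; nra.
Qed.

(** The equation bounds [Cmod (h2 t)] by [Cmod (h1 t)] and [Cmod (h t)], with [V] entering only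
    through [Rabs (V t)]; mixed products are absorbed by [2 p q <= p^2 + q^2]. *)
Lemma energy_derive : exists (N1 : R -> R) (K : R), 0 <= K /\ forall t,
  is_derive energy t (N1 t) /\ N1 t <= K * (1 + Rabs (V t)) * energy t.
Proof.
case: Hode => h2 [Hd Heq].
exists (fun t => 2 * (fst (h t) * fst (h1 t) + snd (h t) * snd (h1 t)) +
                 2 * (fst (h1 t) * fst (h2 t) + snd (h1 t) * snd (h2 t))).
exists (1 + 2 * Cmod a + Cmod b + Cmod c).
have Ha := Cmod_ge_0 a; have Hb := Cmod_ge_0 b; have Hc := Cmod_ge_0 c.
split; first lra.
move=> t; split.
- have [/is_derive_pair [D1 D2] /is_derive_pair [D3 D4]] := Hd t.
  have D := is_derive_plus _ _ _ _ _
    (is_derive_sum_sqr D1 D2) (is_derive_sum_sqr D3 D4).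
  apply: is_derive_ext D => s.
  by rewrite /energy !Cmod_sqr.
- have Hp := Cmod_ge_0 (h t); have Hq := Cmod_ge_0 (h1 t).
  have Hv := Rabs_pos (V t).
  have I1 := Cdot_le_Cmod (h t) (h1 t).
  have I2 := Cdot_le_Cmod (h1 t) (h2 t).
  have I3 : Cmod (h2 t) <= Cmod a * Cmod (h1 t) + (Cmod b * Rabs (V t) + Cmod c) * Cmod (h t).
    rewrite Heq; apply: Rle_trans (Cmod_triangle _ _) _.
    rewrite !Cmod_mult; apply: Rplus_le_compat_l; apply: Rmult_le_compat_r => //.
    apply: Rle_trans (Cmod_triangle _ _) _.
    by rewrite Cmod_mult Cmod_R; apply: Rle_refl.
  have I4 := Rmult_le_compat_l _ _ _ Hq I3.
  rewrite /energy.
  move: (Cmod (h t)) (Cmod (h1 t)) (Cmod (h2 t)) (Cmod a) (Cmod b) (Cmod c) (Rabs (V t))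
    Hp Hq Ha Hb Hc Hv I1 I2 I4 => p q s A B D v Hp Hq Ha Hb Hc Hv I1 I2 I4.
  have I5 : 2 * (p * q) <= p * p + q * q.
    by have := Rle_0_sqr (p - q); rewrite /Rsqr; lra.
  have HBv := Rmult_le_pos _ _ Hb Hv; have HAv := Rmult_le_pos _ _ Ha Hv.
  have HDv := Rmult_le_pos _ _ Hc Hv.
  have Hw : 0 <= B * v + D by lra.
  have I6 := Rmult_le_compat_l _ _ _ Hw I5.
  have I7 : 0 <= A * (p * p).
    by apply: Rmult_le_pos => //; apply: Rmult_le_pos.
  have I8 : 0 <= p * p + q * q.
    by have := Rmult_le_pos _ _ Hp Hp; have := Rmult_le_pos _ _ Hq Hq; lra.
  (* The first factor is [K * (1 + v)] minus the [1 + 2 * A + B * v + D] obtained from the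
     estimates. *)
  have I9 : 0 <= (v + 2 * A * v + B + D * v) * (p * p + q * q).
    by apply: Rmult_le_pos => //; lra.
  lra.
Qed.

(** A supremum argument: the energy vanishes up to a maximal point [m], hence at [m] by continuity.
    If [m < x], the Gronwall estimate to the right of [m] would extend the vanishing, even when [V]
    is discontinuous at [m]. *)
Lemma linear_ode_unique_right (x0 : R) :
  (forall x, right_primitive_abs V x) -> h x0 = RtoC 0 -> h1 x0 = RtoC 0 ->
  forall x, x0 <= x -> h x = RtoC 0.
Proof.
move=> HV Hh Hh1 x Hx.
have [N1 [K [HK HN]]] := energy_derive.
have Ncont t : continuous energy t.
  by apply: ex_derive_continuous; exists (N1 t); apply: (proj1 (HN t)).
pose S y := x0 <= y <= x /\ forall z, x0 <= z <= y -> energy z = 0.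
have S0 : S x0.
  split; first lra; move=> z Hz; rewrite (_ : z = x0); last lra.
  by rewrite /energy Hh Hh1 Cmod_0; ring.
have [m [Hub Hlub]] : {m | is_lub S m}.
  by apply: completeness; [exists x => y [Hy _]; lra | exists x0].
have Hm0 : x0 <= m by apply: Hub.
have Hmx : m <= x by apply: Hlub => y [Hy _]; lra.
have Hlt z : x0 <= z < m -> energy z = 0.
  move=> Hz; apply: NNPP => Hne.
  suff : m <= z by lra.
  apply: Hlub => y [Hy HyS]; apply: Rnot_lt_le => Hzy.
  by apply: Hne; apply: HyS; lra.
have Hm : energy m = 0.
  apply: NNPP => Hne; have Hpos : 0 < energy m.
    by have := energy_ge0 m; lra.
  have [eps Heps] := Ncont m _ (open_gt 0 (energy m) Hpos).
  have He := cond_pos eps.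
  case: (Rle_lt_or_eq_dec _ _ Hm0) => Hcase; last first.
    by apply: Hne; rewrite -Hcase; case: S0 => _; apply; lra.
  pose z := Rmax x0 (m - eps / 2).
  have Hz1 := Rmax_l x0 (m - eps / 2); have Hz2 := Rmax_r x0 (m - eps / 2).
  have Hz3 : z < m by apply: Rmax_lub_lt; lra.
  rewrite -/z in Hz1 Hz2.
  have : 0 < energy z.
    apply: Heps; rewrite /ball /= /AbsRing_ball /abs /minus /plus /Hierarchy.opp /=.
    by rewrite Rabs_left; lra.
  by rewrite Hlt; lra.
case: (Rle_lt_or_eq_dec _ _ Hmx) => Hcase; last first.
  by rewrite -Hcase; apply: (proj1 (energy_eq0 Hm)).
have [b' [B [phi [Hmb Hphi]]]] := HV m.
have Hzero := gronwall_right (N1 := N1) (phi := phi) (v := fun t => Rabs (V t))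
  (B := B) Hmb (Ncont m) Hm HK.
pose y := Rmin x ((m + b') / 2).
have Hy1 := Rmin_l x ((m + b') / 2); have Hy2 := Rmin_r x ((m + b') / 2).
have Hy3 : m < y by apply: Rmin_glb_lt; lra.
rewrite -/y in Hy1 Hy2.
suff : y <= m by lra.
apply: Hub; split; first lra.
move=> z Hz; case: (Rlt_le_dec z m) => Hzm; first by apply: Hlt; lra.
case: (Req_dec z m) => [-> // | Hne].
apply: Hzero; last lra.
move=> t Ht; have [H1 H2] := Hphi t Ht; have [H3 H4] := HN t.
by split=> //; apply: energy_ge0.
Qed.

End Uniqueness.

Lemma linear_ode_unique (a b c : C) (V : R -> R) (h h1 : R -> C) (x0 : R) :
  (forall x, right_primitive_abs V x) ->
  (forall x, right_primitive_abs (fun t => V (- t)) x) ->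
  linear_ode a b c V h h1 -> h x0 = RtoC 0 -> h1 x0 = RtoC 0 ->
  forall x, h x = RtoC 0.
Proof.
move=> HV HV' Hode H0 H1 x; case: (Rle_lt_dec x0 x) => Hx.
  exact: (linear_ode_unique_right Hode HV H0 H1).
have := @linear_ode_unique_right _ _ _ _ _ _ (linear_ode_opp Hode) (- x0) HV'.
rewrite !Ropp_involutive H0 H1 => /(_ erefl) H.
by rewrite -(Ropp_involutive x); apply: H; [ring | lra].
Qed.

(** * Bounded functions with dependent translates *)

(* The two cases of the proof are the vanishing and nonvanishing at one point
   of the Wronskian of [f] and its translate. *)
Lemma translates_dependent (a b c : C) (V : R -> R) (f f1 : R -> C) :
  (forall x, right_primitive_abs V x) ->
  (forall x, right_primitive_abs (fun t => V (- t)) x) ->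
  (forall x, V (x + 1) = V x) -> linear_ode a b c V f f1 ->
  exists al be : C, forall x,
    f (x + 1 + 1) = Cplus (Cmult al (f (x + 1))) (Cmult be (f x)).
Proof.
move=> HV HV' Hper Hf.
case: (classic (exists x0, f x0 <> RtoC 0)) => [[x0 Hx0] | Hzero]; last first.
  have H x : f x = RtoC 0 by apply: NNPP => Hx; apply: Hzero; exists x.
  by exists (RtoC 0), (RtoC 0) => x; rewrite !H; ring.
have Hg := linear_ode_shift Hper Hf; have Hk := linear_ode_shift Hper Hg.
have Hcomb al be := linear_ode_plus Hk
  (linear_ode_plus (linear_ode_scal (Copp al) Hg) (linear_ode_scal (Copp be) Hf)).
have Hconcl al be :
  f (x0 + 1 + 1) = Cplus (Cmult al (f (x0 + 1))) (Cmult be (f x0)) ->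
  f1 (x0 + 1 + 1) = Cplus (Cmult al (f1 (x0 + 1))) (Cmult be (f1 x0)) ->
  exists al be : C, forall x,
    f (x + 1 + 1) = Cplus (Cmult al (f (x + 1))) (Cmult be (f x)).
  move=> E E1; exists al, be => x.
  have := linear_ode_unique (x0 := x0) HV HV' (Hcomb al be).
  cbv beta; rewrite {}E {}E1 => H.
  have {}H := H ltac:(ring) ltac:(ring) x.
  by rewrite -[RHS]Cplus_0_r -{}H; ring.
pose w := Cminus (Cmult (f x0) (f1 (x0 + 1))) (Cmult (f1 x0) (f (x0 + 1))).
case: (classic (w = RtoC 0)) => Hw; last first.
  (* Nonzero Wronskian: Cramer's rule expresses the data of the second translate at [x0] by those of
     the first translate and of [f]. *)
  apply: (Hconcl
    (Cdiv (Cminus (Cmult (f x0) (f1 (x0 + 1 + 1))) (Cmult (f1 x0) (f (x0 + 1 + 1)))) w)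
    (Cdiv (Cminus (Cmult (f (x0 + 1 + 1)) (f1 (x0 + 1)))
                  (Cmult (f1 (x0 + 1 + 1)) (f (x0 + 1)))) w));
    rewrite /w; field; exact: Hw.
(* Zero Wronskian: since [f x0] is nonzero, the data of the translate at [x0] are [mu] times those
   of [f]. *)
pose mu := Cdiv (f (x0 + 1)) (f x0).
have Hmu x : f (x + 1) = Cmult mu (f x).
  have := linear_ode_unique (x0 := x0) HV HV'
    (linear_ode_plus Hg (linear_ode_scal (Copp mu) Hf)).
  have E0 : Cplus (f (x0 + 1)) (Cmult (Copp mu) (f x0)) = RtoC 0.
    by rewrite /mu; field.
  have E1 : Cplus (f1 (x0 + 1)) (Cmult (Copp mu) (f1 x0)) = RtoC 0.
    replace (Cplus (f1 (x0 + 1)) (Cmult (Copp mu) (f1 x0))) with (Cdiv w (f x0)).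
      by rewrite Hw; field.
    by rewrite /w /mu; field.
  cbv beta => /(_ E0 E1 x) H.
  by rewrite -[RHS]Cplus_0_r -{}H; ring.
by exists mu, (RtoC 0) => x; rewrite (Hmu (x + 1)); ring.
Qed.

(** The half-angle formulas: the real and imaginary parts have squares [(m + x) / 2] and
    [(m - x) / 2], and the imaginary part takes the sign of [y]. *)
Lemma Csqrt_exists (z : C) : exists s, Cmult s s = z.
Proof.
case: z => x y; set m := Cmod (x, y).
have Hm : m * m = x * x + y * y by rewrite /m Cmod_sqr.
have Hm0 : 0 <= m by apply: Cmod_ge_0.
have [Hx1 Hx2] : - m <= x <= m by nra.
have Hu : sqrt ((m + x) / 2) * sqrt ((m + x) / 2) = (m + x) / 2.
  by apply: sqrt_sqrt; lra.
have Hv : sqrt ((m - x) / 2) * sqrt ((m - x) / 2) = (m - x) / 2.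
  by apply: sqrt_sqrt; lra.
have Huv : sqrt ((m + x) / 2) * sqrt ((m - x) / 2) = Rabs y / 2.
  rewrite -sqrt_mult; [|lra..].
  replace ((m + x) / 2 * ((m - x) / 2)) with (Rsqr (y / 2)).
    by rewrite sqrt_Rsqr_abs Rabs_div // (Rabs_pos_eq 2) //; lra.
  by rewrite /Rsqr; nra.
case: (Rle_dec 0 y) => Hy.
- exists (sqrt ((m + x) / 2), sqrt ((m - x) / 2)); rewrite /Cmult /= Hu Hv.
  rewrite Rabs_pos_eq // in Huv.
  by congr pair; lra.
- exists (sqrt ((m + x) / 2), - sqrt ((m - x) / 2)).
  rewrite Rabs_left in Huv; last lra.
  by rewrite /Cmult /=; congr pair; nra.
Qed.

(** These are the roots of [z^2 - al z - be], which factor the relation between translates as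
    [(T - mu) (T - nu) f = 0]. *)
Lemma Cquadratic_roots (al be : C) :
  exists mu nu, Cplus mu nu = al /\ Cmult mu nu = Copp be.
Proof.
have [s Hs] := Csqrt_exists (Cplus (Cmult al al) (Cmult (RtoC 4) be)).
exists (Cdiv (Cplus al s) (RtoC 2)), (Cdiv (Cminus al s) (RtoC 2)).
have H2 : RtoC 2 <> RtoC 0 by move=> /RtoC_inj; lra.
split; first by field.
replace (Cmult (Cdiv (Cplus al s) (RtoC 2)) (Cdiv (Cminus al s) (RtoC 2))) with
  (Cdiv (Cminus (Cmult al al) (Cmult s s)) (Cmult (RtoC 2) (RtoC 2))) by field.
rewrite Hs; replace (RtoC 4) with (Cmult (RtoC 2) (RtoC 2)).
  by field.
by rewrite -RtoC_mult; congr RtoC; ring.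
Qed.

Lemma INR_bounded_le0 (e M : R) : (forall n, INR n * e <= M) -> e <= 0.
Proof.
move=> H; apply: Rnot_lt_le => He.
have [n Hn] := INR_unbounded (M / e).
have := H n; apply: Rlt_not_le.
apply: (Rmult_lt_reg_r (/ e)); first exact: Rinv_0_lt_compat.
by rewrite Rmult_assoc Rinv_r ?Rmult_1_r //; lra.
Qed.

(** By Bernoulli's inequality the powers of [q > 1] grow at least linearly. *)
Lemma pow_bounded_le1 (q e M : R) :
  0 < e -> (forall n, q ^ n * e <= M) -> q <= 1.
Proof.
move=> He H; apply: Rnot_lt_le => Hq.
suff : (q - 1) * e <= 0 by apply: Rlt_not_le; apply: Rmult_lt_0_compat; lra.
apply: (@INR_bounded_le0 _ M) => n.
have Hpoly := Rfunctions.poly n (q - 1) ltac:(lra).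
rewrite (_ : 1 + (q - 1) = q) in Hpoly; last ring.
apply: Rle_trans (H n); rewrite -Rmult_assoc.
by apply: Rmult_le_compat_r; lra.
Qed.

(** Boundedness along [x0 + n] gives [Cmod mu <= 1]; boundedness along [x0 - n] gives the same for
    the inverse. *)
Lemma bounded_eigen_unit (p : R -> C) (mu : C) (M x0 : R) :
  (forall x, Cmod (p x) <= M) -> (forall x, p (x + 1) = Cmult mu (p x)) ->
  p x0 <> RtoC 0 -> Cmod mu = 1.
Proof.
move=> HM Hp Hx0.
have Hiter n x : p (x + INR n) = Cmult (Cpow mu n) (p x).
  elim: n => [|n IH]; first by rewrite /= Rplus_0_r; ring.
  by rewrite S_INR -Rplus_assoc Hp IH /=; ring.
have He := proj1 (Cmod_gt_0 _) Hx0.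
apply: Rle_antisym.
  apply: (pow_bounded_le1 (M := M) He) => n.
  by rewrite -Cmod_pow -Cmod_mult -Hiter.
have Hmu : mu <> RtoC 0.
  move=> Hmu; apply: Hx0.
  rewrite (_ : x0 = x0 - 1 + 1); last ring.
  by rewrite Hp Hmu; ring.
have Hmu0 := proj1 (Cmod_gt_0 _) Hmu.
suff : / Cmod mu <= 1.
  move=> Hinv; apply: Rnot_lt_le => Hlt.
  have := Rinv_lt_contravar (Cmod mu) 1; rewrite Rinv_1 Rmult_1_r; lra.
apply: (pow_bounded_le1 (M := M) He) => n.
rewrite pow_inv -Cmod_pow Rmult_comm.
have Hpow : 0 < Cmod (Cpow mu n) by rewrite Cmod_pow; apply: pow_lt.
apply/Rle_div_l => //.
rewrite (_ : x0 = x0 - INR n + INR n); last ring.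
rewrite Hiter Cmod_mult Rmult_comm.
by apply: Rmult_le_compat_r; [lra | exact: HM].
Qed.

(* For a double root [mu] the translates grow linearly,
   [mu f(x + n) = mu^n (mu f(x) + n p(x))] with [p = f(. + 1) - mu f]. *)
Lemma bounded_no_Jordan (f : R -> C) (mu : C) (M : R) :
  (forall x, Cmod (f x) <= M) -> Cmod mu = 1 ->
  (forall x, Cminus (f (x + 1 + 1)) (Cmult mu (f (x + 1))) =
             Cmult mu (Cminus (f (x + 1)) (Cmult mu (f x)))) ->
  forall x, f (x + 1) = Cmult mu (f x).
Proof.
move=> HM Hmu Hf x.
pose p y := Cminus (f (y + 1)) (Cmult mu (f y)).
have Hp1 y : p (y + 1) = Cmult mu (p y) by exact: Hf.
have Hp n : p (x + INR n) = Cmult (Cpow mu n) (p x).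
  elim: n => [|n IH]; first by rewrite /= Rplus_0_r; ring.
  by rewrite S_INR -Rplus_assoc Hp1 IH /=; ring.
(* The factor [mu] on the left avoids the exponent [n - 1], which would be truncated at [n = 0]. *)
have Hn n : Cmult mu (f (x + INR n)) =
    Cmult (Cpow mu n) (Cplus (Cmult mu (f x)) (Cmult (RtoC (INR n)) (p x))).
  elim: n => [|n IH]; first by rewrite /= Rplus_0_r; ring.
  rewrite S_INR -Rplus_assoc RtoC_plus.
  replace (f (x + INR n + 1)) with (Cplus (p (x + INR n)) (Cmult mu (f (x + INR n)))).
    by rewrite IH Hp /=; ring.
  by rewrite /p; ring.
have Hbound n : INR n * Cmod (p x) <= M + M.
  have E : Cmod (Cplus (Cmult mu (f x)) (Cmult (RtoC (INR n)) (p x))) <= M.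
    have := congr1 Cmod (Hn n).
    by rewrite !Cmod_mult Cmod_pow Hmu pow1 !Rmult_1_l => <-.
  rewrite -{1}(Rabs_pos_eq (INR n)); last exact: pos_INR.
  rewrite -Cmod_R -Cmod_mult.
  replace (Cmult (RtoC (INR n)) (p x)) with
    (Cplus (Cplus (Cmult mu (f x)) (Cmult (RtoC (INR n)) (p x))) (Copp (Cmult mu (f x))))
    by ring.
  apply: Rle_trans (Cmod_triangle _ _) _.
  by apply: Rplus_le_compat => //; rewrite Cmod_opp Cmod_mult Hmu Rmult_1_l.
have Hpx : p x = RtoC 0.
  apply: Cmod_eq_0; apply: Rle_antisym; last exact: Cmod_ge_0.
  exact: INR_bounded_le0 Hbound.
by rewrite -[RHS]Cplus_0_l -Hpx /p; ring.
Qed.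

(** The second alternative is [(T - mu) (T - nu) f = 0] written out; [mu <> nu] allows division by
    [mu - nu] in the projections. [T] is abstract so as to cover both translations of the line and
    lattice translations of space. *)
Definition unimodular_split (X : Type) (T : X -> X) (f : X -> C) : Prop :=
  exists mu nu, [/\ Cmod mu = 1, Cmod nu = 1 &
    (forall x, f (T x) = Cmult mu (f x)) \/
    (mu <> nu /\ forall x, f (T (T x)) =
       Cminus (Cmult (Cplus mu nu) (f (T x))) (Cmult (Cmult mu nu) (f x)))].

Lemma bounded_unimodular_split (f : R -> C) (al be : C) (M : R) :
  (forall x, Cmod (f x) <= M) ->
  (forall x, f (x + 1 + 1) = Cplus (Cmult al (f (x + 1))) (Cmult be (f x))) ->
  unimodular_split (Rplus^~ 1) f.
Proof.
move=> HM Hrel.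
have [mu [nu [Hsum Hprod]]] := Cquadratic_roots al be.
have {}Hrel x : f (x + 1 + 1) =
    Cminus (Cmult (Cplus mu nu) (f (x + 1))) (Cmult (Cmult mu nu) (f x)).
  by rewrite Hrel Hsum Hprod; ring.
have Heig la : (forall x, f (x + 1) = Cmult la (f x)) ->
    unimodular_split (Rplus^~ 1) f.
  move=> Hla; case: (classic (exists x, f x <> RtoC 0)) => [[x0 Hx0] | Hzero].
    by exists la, la; rewrite (bounded_eigen_unit HM Hla Hx0); split=> //; left.
  (* The zero function has every number as eigenvalue; [1] is a unimodular choice. *)
  exists (RtoC 1), (RtoC 1); rewrite Cmod_1; split=> //; left=> x.
  have H y : f y = RtoC 0 by apply: NNPP => Hy; apply: Hzero; exists y.
  by rewrite !H; ring.
(* Unless it vanishes, [(T - ka) f] is a bounded eigenfunction with eigenvalue [la]. *)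
have Hroot la ka : (forall x, f (x + 1 + 1) =
     Cminus (Cmult (Cplus la ka) (f (x + 1))) (Cmult (Cmult la ka) (f x))) ->
   (forall x, f (x + 1) = Cmult ka (f x)) \/ Cmod la = 1.
  move=> Hlk; case: (classic (forall x, f (x + 1) = Cmult ka (f x))); first by left.
  move=> /not_all_ex_not [x0 Hx0]; right.
  apply: (@bounded_eigen_unit (fun x => Cminus (f (x + 1)) (Cmult ka (f x))) la
    (M + Cmod ka * M) x0).
  - move=> x; apply: Rle_trans (Cmod_triangle _ _) _.
    rewrite Cmod_opp Cmod_mult; apply: Rplus_le_compat => //.
    by apply: Rmult_le_compat_l => //; apply: Cmod_ge_0.
  - by move=> x; rewrite Hlk; ring.
  - by move=> H; apply: Hx0; rewrite -[RHS]Cplus_0_l -H; ring.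
case: (Hroot _ _ Hrel) => [/Heig // | Hmu].
have Hrel' x : f (x + 1 + 1) =
    Cminus (Cmult (Cplus nu mu) (f (x + 1))) (Cmult (Cmult nu mu) (f x)).
  by rewrite Hrel; ring.
case: (Hroot _ _ Hrel') => [/Heig // | Hnu].
case: (classic (mu = nu)) => Heq; last by exists mu, nu; split=> //; right.
subst nu; apply: (Heig mu).
by apply: (bounded_no_Jordan HM Hmu) => x; rewrite Hrel; ring.
Qed.

Lemma bounded_ode_unimodular_split (a b c : C) (V : R -> R) (f f1 : R -> C) (M : R) :
  (forall x, right_primitive_abs V x) ->
  (forall x, right_primitive_abs (fun t => V (- t)) x) ->
  (forall x, V (x + 1) = V x) -> linear_ode a b c V f f1 ->
  (forall x, Cmod (f x) <= M) -> unimodular_split (Rplus^~ 1) f.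
Proof.
move=> HV HV' Hper Hf HM.
have [al [be Hrel]] := translates_dependent HV HV' Hper Hf.
exact: bounded_unimodular_split HM Hrel.
Qed.

(** * Lattice coordinates *)

HB.instance Definition _ := Monoid.isComLaw.Build C (RtoC 0) Cplus
  Cplus_assoc Cplus_comm Cplus_0_l.
HB.instance Definition _ := Monoid.isComLaw.Build C (RtoC 1) Cmult
  Cmult_assoc Cmult_comm Cmult_1_l.

Lemma big_Cplus_distrl (I : finType) (F : I -> C) (z : C) :
  \big[Cplus/RtoC 0]_i Cmult (F i) z = Cmult (\big[Cplus/RtoC 0]_i F i) z.
Proof.
rewrite (big_morph (Cmult^~ z) (id1 := RtoC 0) (op1 := Cplus)) //.
- by move=> u w; ring.
- by ring.
Qed.

Lemma big_Cplus_distrr (I : finType) (F : I -> C) (z : C) :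
  \big[Cplus/RtoC 0]_i Cmult z (F i) = Cmult z (\big[Cplus/RtoC 0]_i F i).
Proof.
by rewrite Cmult_comm -big_Cplus_distrl; apply: eq_bigr => i _; apply: Cmult_comm.
Qed.

Lemma big_Cplus_RtoC (I : finType) (F : I -> R) :
  \big[Cplus/RtoC 0]_i RtoC (F i) = RtoC (\big[Rplus/0]_i F i).
Proof. by rewrite (big_morph RtoC (id1 := RtoC 0) (op1 := Cplus) RtoC_plus). Qed.

Lemma big_Cmult_neq0 (I : finType) (F : I -> C) (i : I) :
  \big[Cmult/RtoC 1]_i F i <> RtoC 0 -> F i <> RtoC 0.
Proof. by move=> H Hi; apply: H; rewrite (bigD1 i) //= Hi Cmult_0_l. Qed.

(** Mere existence suffices: in the restricted equation only the values of these derivatives at [0]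
    appear, as constants. *)
Lemma twice_derivable_big_mult (I : Type) (s : seq I) (P : pred I) (F : I -> R -> C) :
  (forall i, exists f1 f2, twice_derivable (F i) f1 f2) ->
  exists f1 f2,
    twice_derivable (fun x => \big[Cmult/RtoC 1]_(i <- s | P i) F i x) f1 f2.
Proof.
move=> HF; elim: s => [|i s [f1 [f2 Hf]]].
  exists (fun=> RtoC 0), (fun=> RtoC 0).
  have -> : (fun x => \big[Cmult/RtoC 1]_(i <- [::] | P i) F i x) = fun=> RtoC 1.
    by apply: functional_extensionality => x; rewrite big_nil.
  exact: twice_derivable_const.
have E x : \big[Cmult/RtoC 1]_(k <- i :: s | P k) F k x =
    if P i then Cmult (F i x) (\big[Cmult/RtoC 1]_(k <- s | P k) F k x)
    else \big[Cmult/RtoC 1]_(k <- s | P k) F k x by rewrite big_cons.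
rewrite (functional_extensionality _ _ E); case: (P i).
- have [g1 [g2 Hg]] := HF i.
  by do 2 eexists; apply: (twice_derivable_mult Hg Hf).
- by exists f1, f2.
Qed.

Lemma sum_sqr_eq0 (I : finType) (F : I -> R) :
  \big[Rplus/0]_i (F i * F i) = 0 -> forall i, F i = 0.
Proof.
move=> H i; apply: Rsqr_0_uniq; rewrite /Rsqr; apply: Rle_antisym; last by nra.
rewrite -H (bigD1 i) //=.
have : 0 <= \big[Rplus/0]_(k | k != i) (F k * F k).
  apply: (big_ind (fun x => 0 <= x)) => [|x y Hx Hy|k _]; [lra | lra | nra].
lra.
Qed.

Lemma vsum_delta (d : nat) (v : 'I_d -> vec d) (F : 'I_d -> R) (j : 'I_d) :
  F j = 1 -> (forall k, k != j -> F k = 0) ->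
  vsum (fun k => vscale (F k) (v k)) = v j.
Proof.
move=> Hj Hk; have -> : vsum (fun k => vscale (F k) (v k)) = (\sum_k F k *: v k)%R by [].
rewrite (bigD1 j) //= Hj big1 ?GRing.addr0 => [|k /Hk ->]; last exact: GRing.scale0r.
exact: GRing.scale1r.
Qed.

Lemma evec_decomp (d : nat) (v : vec d) :
  v = (\sum_i coord v i *: evec i)%R.
Proof.
apply/matrixP => i k; rewrite (ord1 k) summxE (bigD1 i) //= !mxE !eqxx big1.
  by rewrite GRing.mulr1 GRing.addr0.
by move=> l Hl; rewrite !mxE eq_sym (negbTE Hl) GRing.mulr0.
Qed.

Section Lattice.
Variables (d : nat) (gamma : 'I_d -> vec d).
Hypothesis Hgamma : lin_indep gamma.

Lemma enorm_neq0 (j : 'I_d) : enorm (gamma j) <> 0.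
Proof.
move=> H.
have Hsum : \big[Rplus/0]_(i < d) (coord (gamma j) i * coord (gamma j) i) = 0.
  apply: sqrt_eq_0 => //.
  by apply: (big_ind (fun x => 0 <= x)) => [|x y Hx Hy|k _]; [lra | lra | nra].
have Hz := sum_sqr_eq0 Hsum.
have := Hgamma (c := fun k => if k == j then 1 else 0).
rewrite (@vsum_delta _ _ _ j) ?eqxx // => [H0 |k /negbTE -> //].
have /H0 /(_ j) : gamma j = const_mx 0.
  by apply/matrixP => i k; rewrite (ord1 k) [LHS]Hz !mxE.
by rewrite eqxx; lra.
Qed.

(** The columns of [Amat gamma] are the normalised [gamma j]. *)
Lemma Amat_scale (c : vec d) :
  mulmx (Amat gamma) c =
  vsum (fun j => vscale (coord c j / enorm (gamma j)) (gamma j)).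
Proof.
rewrite /vsum -[RHS]/(\sum_j (coord c j / enorm (gamma j)) *: gamma j)%R.
apply/matrixP => i k; rewrite (ord1 k) mxE summxE; apply: eq_bigr => j _.
have E (x y z : R) : y <> 0 -> x / y * z = z / y * x by move=> Hy; field.
rewrite !mxE; apply: E; exact: enorm_neq0.
Qed.

(** A kernel vector would be a linear relation between the [gamma j]. The determinant is transposed
    because [det0P] yields left kernel vectors. *)
Lemma Amat_unit : Amat gamma \in unitmx.
Proof.
rewrite unitmxE GRing.unitfE -det_tr; apply/det0P => -[v Hv HvA].
have HA : mulmx (Amat gamma) v^T = const_mx 0.
  by rewrite -[Amat gamma]trmxK -trmx_mul HvA trmx0.
rewrite Amat_scale in HA; move/Hgamma: HA => Hc.
move/negP: Hv; apply; apply/eqP/matrixP => i j; rewrite (ord1 i) [RHS]mxE.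
have := Hc j; rewrite /coord mxE => Hj.
have Hn := @enorm_neq0 j.
have E (x y : R) : y <> 0 -> x / y = 0 -> x = 0.
  by move=> Hy Hxy; rewrite -(Rmult_0_l y) -Hxy; field.
exact: E Hn Hj.
Qed.

Lemma Amat_tilde (r : vec d) : mulmx (Amat gamma) (tilde gamma r) = r.
Proof. by rewrite /tilde mulmxA mulmxV ?Amat_unit // mul1mx. Qed.

Lemma tilde_Amat (y : vec d) : tilde gamma (mulmx (Amat gamma) y) = y.
Proof. by rewrite /tilde mulmxA mulVmx ?Amat_unit // mul1mx. Qed.

Lemma Amat_evec (j : 'I_d) :
  mulmx (Amat gamma) (vscale (enorm (gamma j)) (evec j)) = gamma j.
Proof.
rewrite Amat_scale (@vsum_delta _ _ _ j) //.
- rewrite /coord !mxE !eqxx GRing.mulr1.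
  exact: Rinv_r (@enorm_neq0 j).
- move=> k Hk; rewrite /coord !mxE (negbTE Hk) GRing.mulr0.
  by rewrite /Rdiv Rmult_0_l.
Qed.

Lemma tilde_add (r s : vec d) (j : 'I_d) :
  coord (tilde gamma (vadd r s)) j = coord (tilde gamma r) j + coord (tilde gamma s) j.
Proof. by rewrite /tilde /vadd /coord -[addmx r s]/(r + s)%R mulmxDr mxE. Qed.

Lemma tilde_scale (t : R) (r : vec d) (j : 'I_d) :
  coord (tilde gamma (vscale t r)) j = t * coord (tilde gamma r) j.
Proof. by rewrite /tilde /vscale /coord -[scalemx t r]/(t *: r)%R -scalemxAr mxE. Qed.

Lemma tilde_gamma (j k : 'I_d) :
  coord (tilde gamma (gamma j)) k = if k == j then enorm (gamma j) else 0.
Proof.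
rewrite -{1}(Amat_evec j) tilde_Amat /coord !mxE eqxx andbT.
by case: (k == j); rewrite ?GRing.mulr1 ?GRing.mulr0.
Qed.

(** The sum is the squared gradient of the [j]-th tilde coordinate, the future leading coefficient.
    Were it zero, this coordinate would vanish everywhere, but at [gamma j] it is
    [enorm (gamma j)]. *)
Lemma tilde_evec_neq0 (j : 'I_d) :
  \big[Rplus/0]_(i < d)
    (coord (tilde gamma (evec i)) j * coord (tilde gamma (evec i)) j) <> 0.
Proof.
move=> /sum_sqr_eq0 H; apply: (@enorm_neq0 j).
have := tilde_gamma j j; rewrite eqxx => <-.
rewrite {1}(evec_decomp (gamma j)) /tilde mulmx_sumr /coord summxE big1 // => i _.
by have := H i; rewrite -scalemxAr mxE /coord => ->; rewrite GRing.mulr0.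
Qed.

Lemma gamma_in_lattice (j : 'I_d) : in_lattice gamma (gamma j).
Proof.
exists (fun k => BinInt.Z.b2z (k == j)).
by rewrite (@vsum_delta _ _ _ j) ?eqxx // => k /negbTE ->.
Qed.

End Lattice.

(** * Decomposition into Bloch solutions *)

Lemma vaddAC (d : nat) (r a b : vec d) : vadd (vadd r a) b = vadd (vadd r b) a.
Proof. exact: (GRing.addrAC (r : 'cV[R]_d) a b). Qed.

Lemma second_derive_at_lincomb (f g : R -> C) (t : R) (L M al be : C) :
  second_derive_at f t L -> second_derive_at g t M ->
  second_derive_at (fun x => Cplus (Cmult al (f x)) (Cmult be (g x))) t
    (Cplus (Cmult al L) (Cmult be M)).
Proof.
move=> [f1 [Hf HL]] [g1 [Hg HM]].
exists (fun x => Cplus (Cmult al (f1 x)) (Cmult be (g1 x))); split.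
- apply: filter_imp (filter_and _ _ Hf Hg) => x [H1 H2].
  by apply: is_derive_Cplus; apply: is_derive_Cscal.
- by apply: is_derive_Cplus; apply: is_derive_Cscal.
Qed.

Lemma is_solution_lincomb (d : nat) (V : vec d -> R) (lambda : R)
  (F G : vec d -> C) (al be : C) :
  is_solution V lambda F -> is_solution V lambda G ->
  is_solution V lambda (fun r => Cplus (Cmult al (F r)) (Cmult be (G r))).
Proof.
move=> HF HG r; have [L [HL EL]] := HF r; have [M [HM EM]] := HG r.
exists (fun i => Cplus (Cmult al (L i)) (Cmult be (M i))); split.
  by move=> i; apply: second_derive_at_lincomb.
have -> : \big[Cplus/RtoC 0]_(i < d) Cplus (Cmult al (L i)) (Cmult be (M i)) =
    Cplus (Cmult al (\big[Cplus/RtoC 0]_(i < d) L i)) (Cmult be (\big[Cplus/RtoC 0]_(i < d) M i)).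
  by rewrite -!big_Cplus_distrr -big_split.
transitivity (Cplus (Cmult al (Cmult (RtoC lambda) (F r)))
                    (Cmult be (Cmult (RtoC lambda) (G r)))); last by ring.
by rewrite -EL -EM; ring.
Qed.

(** Projecting in one direction must preserve the relations in all directions; it does since
    translations commute. *)
Lemma unimodular_split_lincomb (X : Type) (T S : X -> X) (f : X -> C) (al be : C) :
  (forall x, T (S x) = S (T x)) -> unimodular_split T f ->
  unimodular_split T (fun x => Cplus (Cmult al (f (S x))) (Cmult be (f x))).
Proof.
move=> HTS [mu [nu [Hmu Hnu H]]]; exists mu, nu; split=> //.
case: H => [H | [Hne H]]; [left=> x | right; split=> // x].
- by rewrite -HTS !H; ring.
- by rewrite -!HTS !H; ring.
Qed.

Lemma unit_circle_angle (mu : C) :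
  Cmod mu = 1 -> exists theta, mu = (cos theta, sin theta).
Proof.
case: mu => x y H.
have Hxy : x * x + y * y = 1 by have := Cmod_sqr (x, y); rewrite H /=; lra.
have Hx : -1 <= x <= 1 by nra.
have Hs : sin (acos x) = Rabs y.
  rewrite sin_acos // -sqrt_Rsqr_abs; congr sqrt; rewrite /Rsqr; lra.
case: (Rle_dec 0 y) => Hy.
- by exists (acos x); rewrite cos_acos // Hs Rabs_pos_eq.
- exists (- acos x); rewrite cos_neg sin_neg cos_acos // Hs Rabs_left; last lra.
  by congr pair; ring.
Qed.

Lemma Cexp_plus (z w : C) : Cexp (Cplus z w) = Cmult (Cexp z) (Cexp w).
Proof.
case: z => a b; case: w => c e; rewrite /Cexp /Cplus /Cmult /=.
by rewrite exp_plus cos_plus sin_plus; congr pair; ring.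
Qed.

Lemma Cexp_0 : Cexp (RtoC 0) = RtoC 1.
Proof. by rewrite /Cexp /= exp_0 cos_0 sin_0 /RtoC; congr pair; ring. Qed.

Section Bloch.
Variables (d : nat) (gamma : 'I_d -> vec d) (V : vec d -> R) (lambda : R).
Hypothesis Hgamma : lin_indep gamma.
Hypothesis HV : lattice_periodic gamma V.

Let shift (j : 'I_d) (r : vec d) : vec d := vadd r (gamma j).

Lemma is_solution_shift (F : vec d -> C) (j : 'I_d) :
  is_solution V lambda F -> is_solution V lambda (fun r => F (vadd r (gamma j))).
Proof.
move=> HF r; have [L [HL EL]] := HF (vadd r (gamma j)).
exists L; split=> [i|].
- have -> : (fun t => F (vadd (vadd r (vscale t (evec i))) (gamma j))) =
            (fun t => F (vadd (vadd r (gamma j)) (vscale t (evec i)))).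
    by apply: functional_extensionality => t; rewrite vaddAC.
  exact: HL.
- by rewrite -EL (HV r (gamma_in_lattice gamma j)).
Qed.

(** Writing the unimodular eigenvalue through a real angle makes the quasimomentum real. *)
Definition shift_eigen (j : 'I_d) (F : vec d -> C) : Prop :=
  exists theta, forall r, F (shift j r) = Cmult (cos theta, sin theta) (F r).

Lemma shift_eigen_lincomb (j k : 'I_d) (F : vec d -> C) (al be : C) :
  shift_eigen j F ->
  shift_eigen j (fun r => Cplus (Cmult al (F (shift k r))) (Cmult be (F r))).
Proof.
move=> [theta H]; exists theta => r.
by rewrite {1}/shift -/(shift k) /shift vaddAC -/(shift _ _) -/(shift j _) !H; ring.
Qed.

(** With [k j = theta j / enorm (gamma j)], the period in direction [j] multiplies the exponential
    by the eigenvalue of [F], so dividing [F] by the exponential leaves a periodic function. *)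
Lemma joint_eigen_Bloch (F : vec d -> C) :
  is_solution V lambda F -> (forall j, shift_eigen j F) ->
  exists k : 'I_d -> R, Bloch_solution gamma V lambda F (fun j => RtoC (k j)).
Proof.
move=> HF /fin_all_exists [theta Htheta].
exists (fun j => theta j / enorm (gamma j)); split=> //.
pose S (y : vec d) := \big[Cplus/RtoC 0]_(j < d)
  Cmult (RtoC (theta j / enorm (gamma j))) (RtoC (coord y j)).
exists (fun y => Cmult (Cexp (Copp (Cmult Defs.Ci (S y)))) (F (mulmx (Amat gamma) y))).
split; last first.
  move=> r; rewrite -/(S _) Amat_tilde // Cmult_assoc -Cexp_plus.
  replace (Cplus (Cmult Defs.Ci (S (tilde gamma r)))
    (Copp (Cmult Defs.Ci (S (tilde gamma r))))) with (RtoC 0) by ring.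
  by rewrite Cexp_0; ring.
move=> j y.
have -> : mulmx (Amat gamma) (vadd y (vscale (enorm (gamma j)) (evec j))) =
    shift j (mulmx (Amat gamma) y).
  rewrite /shift -{2}(Amat_evec Hgamma j).
  exact: (mulmxDr (Amat gamma) (y : 'cV[R]_d)).
rewrite Htheta.
have -> : S (vadd y (vscale (enorm (gamma j)) (evec j))) = Cplus (S y) (RtoC (theta j)).
  have E l : Cmult (RtoC (theta l / enorm (gamma l)))
      (RtoC (coord (vadd y (vscale (enorm (gamma j)) (evec j))) l)) =
      Cplus (Cmult (RtoC (theta l / enorm (gamma l))) (RtoC (coord y l)))
        (if l == j then RtoC (theta j) else RtoC 0).
    have -> : coord (vadd y (vscale (enorm (gamma j)) (evec j))) l =
        coord y l + (if l == j then enorm (gamma j) else 0).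
      rewrite /coord !mxE eqxx andbT.
      by case: (l == j); rewrite ?GRing.mulr1 ?GRing.mulr0.
    have Hn := enorm_neq0 Hgamma (j := j).
    case: eqP => [-> | _]; last by rewrite Rplus_0_r; ring.
    rewrite -!RtoC_mult -RtoC_plus; congr RtoC; by field.
  rewrite /S (eq_bigr _ (fun l _ => E l)) big_split /=; congr Cplus.
  rewrite (bigD1 j) //= eqxx big1 ?Cplus_0_r // => l /negbTE -> //.
rewrite Cmult_assoc; congr Cmult.
have -> : (cos (theta j), sin (theta j)) = Cexp (Cmult Defs.Ci (RtoC (theta j))).
  rewrite /Cexp /Defs.Ci /Cmult /= !(Rmult_0_l, Rmult_0_r, Rmult_1_l, Rplus_0_l).
  by rewrite Rminus_0_r exp_0 !Rmult_1_l.
rewrite -Cexp_plus; congr Cexp; ring.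
Qed.

Definition Bloch_combination (F : vec d -> C) : Prop :=
  exists (n : nat) (c : 'I_n -> C) (k : 'I_n -> 'I_d -> R) (Phi : 'I_n -> vec d -> C),
    (forall m, Bloch_solution gamma V lambda (Phi m) (fun j => RtoC (k m j))) /\
    forall r, F r = \big[Cplus/RtoC 0]_(m < n) Cmult (c m) (Phi m r).

Lemma Bloch_combination_lincomb (F G H : vec d -> C) (al be : C) :
  Bloch_combination F -> Bloch_combination G ->
  (forall r, H r = Cplus (Cmult al (F r)) (Cmult be (G r))) ->
  Bloch_combination H.
Proof.
move=> [n1 [c1 [k1 [Phi1 [B1 E1]]]]] [n2 [c2 [k2 [Phi2 [B2 E2]]]]] HH.
exists (n1 + n2)%N.
exists (fun m => match split m with inl i => Cmult al (c1 i) | inr i => Cmult be (c2 i) end).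
exists (fun m => match split m with inl i => k1 i | inr i => k2 i end).
exists (fun m => match split m with inl i => Phi1 i | inr i => Phi2 i end).
split=> [m | r]; first by case: (split m).
rewrite HH E1 E2 big_split_ord /=; congr Cplus.
- rewrite -big_Cplus_distrr; apply: eq_bigr => i _.
  by rewrite (unsplitK (inl i : 'I_n1 + 'I_n2)); ring.
- rewrite -big_Cplus_distrr; apply: eq_bigr => i _.
  by rewrite (unsplitK (inr i : 'I_n1 + 'I_n2)); ring.
Qed.

(* Induction over the directions in which [F] is not yet an eigenfunction. *)
Lemma split_Bloch_combination (s : seq 'I_d) (F : vec d -> C) :
  is_solution V lambda F -> (forall j, unimodular_split (shift j) F) ->
  (forall j, j \notin s -> shift_eigen j F) -> Bloch_combination F.
Proof.
elim: s F => [|j s IH] F HF Hsplit Heig.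
  have [k Hk] := joint_eigen_Bloch HF (fun j => Heig j isT).
  exists 1%N, (fun=> RtoC 1), (fun=> k), (fun=> F); split=> // r.
  by rewrite big_ord1; ring.
have [mu [nu [Hmu Hnu H]]] := Hsplit j.
have [theta Etheta] := unit_circle_angle Hmu.
have [eta Eeta] := unit_circle_angle Hnu.
case: H => [H | [Hne H]].
  apply: (IH F) => // k Hk; case: (eqVneq k j) => [-> | Hkj].
    by exists theta => r; rewrite H Etheta.
  by apply: Heig; rewrite in_cons negb_or Hkj.
(* For [be] the opposite of one root, [(T_j + be) F] is an eigenfunction of [T_j] for the other
   root, and the induction hypothesis applies to it. *)
have Hproj be th : (forall r, Cplus (F (shift j (shift j r))) (Cmult be (F (shift j r))) =
    Cmult (cos th, sin th) (Cplus (F (shift j r)) (Cmult be (F r)))) ->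
    Bloch_combination (fun r => Cplus (Cmult (RtoC 1) (F (shift j r))) (Cmult be (F r))).
  move=> Hth; apply: IH.
  - by apply: is_solution_lincomb => //; apply: is_solution_shift.
  - by move=> k; apply: unimodular_split_lincomb => // r; apply: vaddAC.
  - move=> k Hk; case: (eqVneq k j) => [-> | Hkj].
      by exists th => r; rewrite !Cmult_1_l Hth.
    by apply: shift_eigen_lincomb; apply: Heig; rewrite in_cons negb_or Hkj.
have Hmn : Cminus mu nu <> RtoC 0.
  by move=> E; apply: Hne; rewrite -[RHS]Cplus_0_l -E; ring.
(* [F] is [(T_j - nu) F] minus [(T_j - mu) F], divided by [mu - nu]. *)
apply: (Bloch_combination_lincomb (al := Cinv (Cminus mu nu))
  (be := Copp (Cinv (Cminus mu nu))) (Hproj (Copp nu) theta _) (Hproj (Copp mu) eta _)).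
- by move=> r; rewrite -Etheta H; ring.
- by move=> r; rewrite -Eeta H; ring.
- by move=> r; field.
Qed.

End Bloch.

(** * Separable solutions *)

Section Separation.
Variables (d : nat) (gamma : 'I_d -> vec d) (Psi : vec d -> C) (r0 : vec d).
Hypothesis Hgamma : lin_indep gamma.
Hypothesis Hsep : separable gamma Psi.
Hypothesis Hr0 : Psi r0 <> RtoC 0.

(** The coordinates of [r - r0] in the basis [gamma]: translation by [gamma j] adds [1] to the
    [j]-th. *)
Definition lattice_coord (r : vec d) (j : 'I_d) : R :=
  (coord (tilde gamma r) j - coord (tilde gamma r0) j) / enorm (gamma j).

(** A normalised substitute for the [j]-th factor in [separable] that inherits its regularity and
    bound from [Psi]. *)
Definition line_factor (j : 'I_d) (t : R) : C :=
  Cdiv (Psi (vadd r0 (vscale t (gamma j)))) (Psi r0).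

Lemma lattice_coord_line (j k : 'I_d) (r : vec d) (t : R) :
  lattice_coord (vadd r (vscale t (gamma j))) k =
  lattice_coord r k + (if k == j then t else 0).
Proof.
rewrite /lattice_coord tilde_add // tilde_scale tilde_gamma //.
have Hk := @enorm_neq0 _ _ Hgamma k.
by case: eqP => [E | _]; [subst k|]; field.
Qed.

Lemma lattice_coord_base (k : 'I_d) : lattice_coord r0 k = 0.
Proof. by rewrite /lattice_coord Rminus_diag /Rdiv Rmult_0_l. Qed.

Lemma line_factor0 (j : 'I_d) : line_factor j 0 = RtoC 1.
Proof.
rewrite /line_factor (_ : vadd _ _ = r0); first by field.
rewrite /vadd /vscale -[scalemx 0 (gamma j)]/(0%R *: gamma j)%R GRing.scale0r.
exact: (GRing.addr0 (r0 : 'cV[R]_d)).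
Qed.

(** Along [gamma j] only the [j]-th factor varies, so [line_factor j] is that factor divided by its
    value at [r0], nonzero because [Psi r0] is. *)
Lemma separable_line_factor (r : vec d) :
  Psi r = Cmult (Psi r0) (\big[Cmult/RtoC 1]_(j < d) line_factor j (lattice_coord r j)).
Proof.
case: Hsep => psi Hpsi.
have Hne j : psi j (coord (tilde gamma r0) j) <> RtoC 0.
  by move: Hr0; rewrite Hpsi => /big_Cmult_neq0; apply.
have E j : line_factor j (lattice_coord r j) =
    Cdiv (psi j (coord (tilde gamma r) j)) (psi j (coord (tilde gamma r0) j)).
  rewrite /line_factor !Hpsi (bigD1 j) //= [in X in Cdiv _ X](bigD1 j) //=.
  rewrite tilde_add // tilde_scale tilde_gamma // eqxx.
  have -> : coord (tilde gamma r0) j + lattice_coord r j * enorm (gamma j) =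
      coord (tilde gamma r) j.
    rewrite /lattice_coord; field; exact: enorm_neq0.
  rewrite (eq_bigr (fun k => psi k (coord (tilde gamma r0) k))).
    have : Psi r0 <> RtoC 0 by [].
    rewrite Hpsi (bigD1 j) //= => Hprod.
    have Hrest : \big[Cmult/RtoC 1]_(k < d | k != j) psi k (coord (tilde gamma r0) k) <> RtoC 0.
      by move=> H; apply: Hprod; rewrite H; ring.
    by field; split.
  by move=> k /negbTE Hk; rewrite tilde_add // tilde_scale tilde_gamma // Hk Rmult_0_r Rplus_0_r.
rewrite (eq_bigr _ (fun j _ => E j)) !Hpsi -big_split /=.
by apply: eq_bigr => j _; have Hj := Hne j; field.
Qed.

Lemma line_factor_twice_derivable (j : 'I_d) :
  tensorCp gamma 2 Psi ->
  exists g1 g2, twice_derivable (line_factor j) g1 g2.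
Proof.
move=> /(_ j r0 true) [f1 [Hf1 [f2 [Hf2 _]]]].
have Hf : twice_derivable (fun t => Psi (vadd r0 (vscale t (gamma j)))) f1 f2.
  by move=> x; split; [exact: Hf1 | exact: Hf2].
exists (fun t => Cmult (Cinv (Psi r0)) (f1 t)), (fun t => Cmult (Cinv (Psi r0)) (f2 t)).
have -> : line_factor j =
    fun t => Cmult (Cinv (Psi r0)) (Psi (vadd r0 (vscale t (gamma j)))).
  by apply: functional_extensionality => t; rewrite /line_factor /Cdiv Cmult_comm.
exact: twice_derivable_scal.
Qed.

(* Moving along a coordinate axis from [r0 + t gamma_j] changes all lattice
   coordinates, but the factors other than the [j]-th do not depend on [t]; so
   the Laplacian is a second order operator in [t] with constant coefficients
   whose leading one is a nonzero sum of squares. *)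
Lemma line_factor_ode (V : vec d -> R) (lambda : R) (j : 'I_d) :
  tensorCp gamma 2 Psi -> is_solution V lambda Psi ->
  exists (a b c : C) g1,
    linear_ode a b c (fun t => V (vadd r0 (vscale t (gamma j)))) (line_factor j) g1.
Proof.
move=> HPsi Hsol.
have Hg k := line_factor_twice_derivable k HPsi.
have [g1 [g2 Hgj]] := Hg j.
(* The rate of change of the [k]-th lattice coordinate along the [i]-th axis. *)
pose beta i k := coord (tilde gamma (evec i)) k / enorm (gamma k).
pose Q i s := \big[Cmult/RtoC 1]_(k < d | k != j) line_factor k (0 + s * beta i k).
have HQ i : exists f1 f2, twice_derivable (Q i) f1 f2.
  apply: (twice_derivable_big_mult _ _ (F := fun k s => line_factor k (0 + s * beta i k))).
  move=> k; have [f1 [f2 Hf]] := Hg k.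
  by do 2 eexists; apply: (twice_derivable_affine _ _ Hf).
have [Q1 /fin_all_exists [Q2 HQd]] := fin_all_exists HQ.
have Q0 i : Q i 0 = RtoC 1.
  by rewrite /Q big1 // => k _; rewrite Rmult_0_l Rplus_0_l line_factor0.
have HPsi_axis i t s :
    Psi (vadd (vadd r0 (vscale t (gamma j))) (vscale s (evec i))) =
    Cmult (Psi r0) (Cmult (line_factor j (t + s * beta i j)) (Q i s)).
  have Hc k : lattice_coord (vadd (vadd r0 (vscale t (gamma j))) (vscale s (evec i))) k =
      (if k == j then t else 0) + s * beta i k.
    rewrite -[if _ then _ else _]Rplus_0_l -{1}(lattice_coord_base k).
    rewrite -lattice_coord_line /lattice_coord tilde_add // tilde_scale /beta.
    field; exact: enorm_neq0.
  rewrite separable_line_factor (bigD1 j) //= Hc eqxx; congr Cmult; congr Cmult.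
  by apply: eq_bigr => k /negbTE Hk; rewrite Hc Hk.
(* With [g] the [j]-th line factor, the Laplacian on the line is [Psi r0] times
   [S g'' + 2 P g' + Z g]. *)
pose S := \big[Rplus/0]_(i < d) (beta i j * beta i j).
pose P := \big[Cplus/RtoC 0]_(i < d) Cmult (RtoC (beta i j)) (Q1 i 0).
pose Z := \big[Cplus/RtoC 0]_(i < d) Q2 i 0.
have HS : S <> 0.
  move=> /sum_sqr_eq0 HS; apply: (@tilde_evec_neq0 _ _ Hgamma j).
  apply: big1 => i _.
  have -> : coord (tilde gamma (evec i)) j = beta i j * enorm (gamma j).
    by rewrite /beta; field; apply: enorm_neq0.
  by rewrite HS !Rmult_0_l.
have HSC : RtoC S <> RtoC 0 by move=> /RtoC_inj.
(* Read off from [S g'' + 2 P g' + Z g = 2 (V - lambda) g], solved for [g'']. *)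
exists (Cdiv (Cmult (RtoC (-2)) P) (RtoC S)), (Cdiv (RtoC 2) (RtoC S)),
  (Cdiv (Cminus (RtoC (-2 * lambda)) Z) (RtoC S)), g1, g2; split=> // t.
have [L [HL EL]] := Hsol (vadd r0 (vscale t (gamma j))).
have HLi i : L i = Cmult (Psi r0) (Cplus (Cplus
    (Cmult (RtoC (beta i j * beta i j)) (g2 t))
    (Cmult (Cmult (RtoC (beta i j)) (Q1 i 0)) (Cmult (RtoC 2) (g1 t))))
    (Cmult (Q2 i 0) (line_factor j t))).
  have := HL i; rewrite (functional_extensionality _ _ (HPsi_axis i t)) => HLi.
  have Hd := twice_derivable_scal (Psi r0)
    (twice_derivable_mult (twice_derivable_affine t (beta i j) Hgj) (HQd i)).
  rewrite (second_derive_at_twice_derivable Hd HLi) Q0 Rmult_0_l Rplus_0_r.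
  by rewrite (RtoC_plus 1 1 : RtoC 2 = _); ring.
have HLsum : \big[Cplus/RtoC 0]_(i < d) L i = Cmult (Psi r0) (Cplus (Cplus
    (Cmult (RtoC S) (g2 t)) (Cmult P (Cmult (RtoC 2) (g1 t))))
    (Cmult Z (line_factor j t))).
  rewrite (eq_bigr _ (fun i _ => HLi i)) big_Cplus_distrr; congr Cmult.
  rewrite !big_split /=; congr Cplus; first congr Cplus.
  - by rewrite big_Cplus_distrl big_Cplus_RtoC.
  - by rewrite big_Cplus_distrl.
  - by rewrite big_Cplus_distrl.
have HPsit : Psi (vadd r0 (vscale t (gamma j))) = Cmult (Psi r0) (line_factor j t).
  by rewrite /line_factor; field.
rewrite HLsum HPsit in EL.
have H2 : RtoC 2 <> RtoC 0 by move=> /RtoC_inj; lra.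
have Ehalf : RtoC (-1 / 2) = Copp (Cinv (RtoC 2)).
  rewrite -RtoC_inv; last lra.
  by rewrite -RtoC_opp; congr RtoC; field.
have EL' : Cplus (Cplus (Cmult (RtoC S) (g2 t)) (Cmult P (Cmult (RtoC 2) (g1 t))))
    (Cmult Z (line_factor j t)) =
    Cmult (Cmult (RtoC 2)
      (Cminus (RtoC (V (vadd r0 (vscale t (gamma j))))) (RtoC lambda))) (line_factor j t).
  transitivity (Cmult (Cdiv (Copp (RtoC 2)) (Psi r0))
    (Cminus (Cmult (RtoC lambda) (Cmult (Psi r0) (line_factor j t)))
       (Cmult (RtoC (V (vadd r0 (vscale t (gamma j)))))
         (Cmult (Psi r0) (line_factor j t))))).
    by rewrite -EL Ehalf; field.
  by field.
have -> : g2 t = Cdiv (Cminus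
    (Cmult (Cmult (RtoC 2)
      (Cminus (RtoC (V (vadd r0 (vscale t (gamma j))))) (RtoC lambda))) (line_factor j t))
    (Cplus (Cmult P (Cmult (RtoC 2) (g1 t))) (Cmult Z (line_factor j t)))) (RtoC S).
  by rewrite -EL'; field.
have -> : RtoC (-2) = Copp (RtoC 2) by rewrite -RtoC_opp; congr RtoC; ring.
have -> : RtoC (-2 * lambda) = Copp (Cmult (RtoC 2) (RtoC lambda)).
  by rewrite -RtoC_mult -RtoC_opp; congr RtoC; ring.
by field.
Qed.

Lemma separable_unimodular_split (j : 'I_d) :
  unimodular_split (Rplus^~ 1) (line_factor j) ->
  unimodular_split (fun r => vadd r (gamma j)) Psi.
Proof.
have Hc r k : lattice_coord (vadd r (gamma j)) k =
    lattice_coord r k + (if k == j then 1 else 0).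
  rewrite -lattice_coord_line /vscale.
  by rewrite -[scalemx 1 (gamma j)]/(1%R *: gamma j)%R GRing.scale1r.
pose rest r := Cmult (Psi r0)
  (\big[Cmult/RtoC 1]_(k < d | k != j) line_factor k (lattice_coord r k)).
have Hrest r : rest (vadd r (gamma j)) = rest r.
  by congr Cmult; apply: eq_bigr => k /negbTE Hk; rewrite Hc Hk Rplus_0_r.
have E r : Psi r = Cmult (rest r) (line_factor j (lattice_coord r j)).
 
    rewrite separable_line_factor (bigD1 j) //= -(Cmult_assoc (Psi r0)); congr Cmult.
    exact: Cmult_comm.
move=> [mu [nu [Hmu Hnu H]]]; exists mu, nu; split=> //.
case: H => [H | [Hne H]]; [left=> r | right; split=> // r].
- by rewrite !E Hrest Hc eqxx H; ring.
- by rewrite !E !Hrest !Hc eqxx H; ring.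
Qed.

End Separation.

Theorem theorem3p10 (d : nat) (gamma : 'I_d -> vec d) (V : vec d -> R) (lambda : R)
  (Psi : vec d -> C) :
  lin_indep gamma ->
  tensorCp gamma 0 V ->
  lattice_periodic gamma V ->
  tensorCp gamma 2 Psi ->
  bounded_fun Psi ->
  is_solution V lambda Psi ->
  separable gamma Psi ->
  exists (n : nat) (c : 'I_n -> C) (k : 'I_n -> 'I_d -> R) (Phi : 'I_n -> vec d -> C),
    (forall m, Bloch_solution gamma V lambda (Phi m) (fun j => RtoC (k m j))) /\
    forall r, Psi r = \big[Cplus/RtoC 0]_(m < n) Cmult (c m) (Phi m r).
Proof.
move=> Hgamma HV0 HV HPsi [M HM] Hsol Hsep.
case: (classic (exists r0, Psi r0 <> RtoC 0)) => [[r0 Hr0] | Hzero]; last first.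
  (* The zero solution is the empty combination. *)
  exists 0%N, (fun=> RtoC 0), (fun _ _ => 0), (fun=> Psi); split=> [[] // | r].
  by rewrite big_ord0; apply: NNPP => Hr; apply: Hzero; exists r.
(* At the start every direction may still need splitting, so the list contains all of them. *)
apply: (split_Bloch_combination Hgamma HV (s := enum 'I_d) Hsol); last first.
  by move=> j; rewrite mem_enum.
move=> j; apply: (separable_unimodular_split Hgamma Hsep Hr0).
have [a [b [c [g1 Hode]]]] := line_factor_ode Hgamma Hsep Hr0 j HPsi Hsol.
apply: (bounded_ode_unimodular_split (M := M / Cmod (Psi r0)) _ _ _ Hode).
- by move=> x; apply: Cp0_right_primitive_abs; apply: (HV0 j r0 true).
(* The direction [- gamma j] supplies the reflected potential for uniqueness to the left. *)
- by move=> x; apply: Cp0_right_primitive_abs; apply: (HV0 j r0 false).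
- move=> t; rewrite -(HV _ (vadd r0 (vscale t (gamma j))) (gamma_in_lattice gamma j)); congr V.
  rewrite /vadd /vscale.
  rewrite -[scalemx (t + 1) (gamma j)]/((t + 1)%R *: gamma j)%R.
  rewrite (GRing.scalerDl (gamma j : 'cV[R]_d) t 1) GRing.scale1r.
  exact: GRing.addrA.
- move=> t; rewrite /line_factor Cmod_div //.
  apply: Rmult_le_compat_r (HM _).
  by left; apply: Rinv_0_lt_compat; apply/Cmod_gt_0.
Qed.
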